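(* Let $S$ and $T$ be two distinct ordered rooted binary trees with the same number of leaves. Let $n$ be the number of internal nodes of each of $S$ and $T$, and let $e$ be the number of common edges of $S$ and $T$. Then the rotation distance $d_R(S,T)$ satisfies $$n-e-1 \;\le\; d_R(S,T) \;\le\; 2(n-e-1).$$
   Context: A tree here is an extended binary tree: a finite ordered (plane) rooted binary tree in which every interior (internal) node has exactly two children, a left child and a right child. A tree with $n$ interior nodes has $n+1$ leaves, numbered $1,\dots,n+1$ in left-to-right order. An internal edge is an edge joining two interior nodes, so a tree with $n\ge 1$ interior nodes has $n-1$ internal edges. Common edges: removing an internal edge of a tree disconnects the tree and so separates the leaves into two sets, the set of leaves below the edge (those descending from its lower endpoint) and the remaining set of leaves (on the side containing the root). An internal edge $e_1$ of $S$ and an internal edge $e_2$ of $T$ form a common edge pair if they induce the same partition of $\{1,\dots,n+1\}$ into the ''below'' set and the ''root side'' set, i.e. the set of leaves below $e_1$ in $S$ equals the set of leaves below $e_2$ in $T$. The number $e$ of common edges of $S$ and $T$ is the number of common edge pairs; equivalently, the number of internal edges of $S$ whose set of leaves below equals the set of leaves below some internal edge of $T$. Rotations: write $(X,Y)$ for the tree or subtree whose root has left subtree $X$ and right subtree $Y$. A right rotation at a node whose left child is an interior node replaces the subtree $((A,B),C)$ rooted at that node by $(A,(B,C))$, leaving the rest of the tree unchanged; here $A,B,C$ are arbitrary subtrees (possibly single leaves). A left rotation is the inverse operation, replacing $(A,(B,C))$ by $((A,B),C)$. The rotation distance $d_R(S,T)$ between two trees with the same number of leaves is the minimum number of (left or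 right) rotations needed to transform $S$ into $T$. *)

(* Defs.v *)
From HB Require Import structures.
From mathcomp Require Import all_boot all_order all_algebra.

Set Implicit Arguments.
Unset Strict Implicit.
Unset Printing Implicit Defensive.

Inductive tree := Leaf | Node of tree & tree.

Fixpoint tree_eqb (s t : tree) : bool :=
  match s, t with
  | Leaf, Leaf => true
  | Node a b, Node c d => tree_eqb a c && tree_eqb b d
  | _, _ => false
  end.

Lemma tree_eqP : Equality.axiom tree_eqb.
Proof.
elim=> [|a IHa b IHb] [|c d] /=; try by constructor.
by apply: (iffP andP) => [[/IHa -> /IHb ->]|[/IHa ? /IHb ?]].
Qed.

HB.instance Definition _ := hasDecEq.Build tree tree_eqP.

(* A node is addressed by the path leading to it from the root:
   [false] is a step to the left child, [true] a step to the right child. *)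
Definition address := seq bool.

(* Left-to-right order. *)
Fixpoint leaves (t : tree) : seq address :=
  if t is Node l r
  then map (cons false) (leaves l) ++ map (cons true) (leaves r)
  else [:: [::]].

Fixpoint interior_nodes (t : tree) : seq address :=
  if t is Node l r
  then [::] :: map (cons false) (interior_nodes l)
            ++ map (cons true) (interior_nodes r)
  else [::].

Definition nb_leaves (t : tree) : nat := size (leaves t).

Definition nb_interior (t : tree) : nat := size (interior_nodes t).

(* An edge is represented by its lower endpoint; the parent of a non-root
   node is always interior, so the internal edges correspond exactly to the
   non-root interior nodes. *)
Definition internal_edges (t : tree) : seq address :=
  [seq p <- interior_nodes t | p != [::]].

(* Leaf number i, 1 <= i <= nb_leaves t, is the i-th entry of [leaves t]; it
   descends from the node at p iff p is a prefix of its address. The result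
   is an increasing sequence, so that equality of these sequences is equality
   of the corresponding sets of leaf numbers. *)
Definition leaves_below (t : tree) (p : address) : seq nat :=
  [seq i <- iota 1 (nb_leaves t) | prefix p (nth [::] (leaves t) i.-1)].

Definition common_edges (s t : tree) : seq (address * address) :=
  [seq pq <- [seq (p, q) | p <- internal_edges s, q <- internal_edges t]
     | leaves_below s pq.1 == leaves_below t pq.2].

Definition nb_common_edges (s t : tree) : nat := size (common_edges s t).

(* All the trees obtained from t by one right rotation, at any node. *)
Fixpoint right_rotations (t : tree) : seq tree :=
  if t is Node l r then
    (if l is Node a b then [:: Node a (Node b r)] else [::])
    ++ [seq Node l' r | l' <- right_rotations l]
    ++ [seq Node l r' | r' <- right_rotations r]
  else [::].

Fixpoint left_rotations (t : tree) : seq tree :=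
  if t is Node l r then
    (if r is Node b c then [:: Node (Node l b) c] else [::])
    ++ [seq Node l' r | l' <- left_rotations l]
    ++ [seq Node l r' | r' <- left_rotations r]
  else [::].

Definition rotations (t : tree) : seq tree :=
  right_rotations t ++ left_rotations t.

(* s can be transformed into t by a sequence of exactly k rotations. *)
Fixpoint rotates_in (k : nat) (s t : tree) : bool :=
  if k is k'.+1 then has (fun u => rotates_in k' u t) (rotations s)
  else s == t.

Lemma right_rotations_sub s t :
  t \in right_rotations s -> s \in left_rotations t.
Proof.
elim: s t => [|l IHl r IHr] t //=; rewrite !mem_cat => /or3P[].
- by case: l {IHl} => [|a b] //; rewrite inE => /eqP -> /=; rewrite inE eqxx.
- case/mapP => l' /IHl Hl ->; rewrite /= !mem_cat; apply/or3P/Or32.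
  by apply/mapP; exists l.
- case/mapP => r' /IHr Hr ->; rewrite /= !mem_cat; apply/or3P/Or33.
  by apply/mapP; exists r.
Qed.

Lemma left_rotations_sub s t :
  t \in left_rotations s -> s \in right_rotations t.
Proof.
elim: s t => [|l IHl r IHr] t //=; rewrite !mem_cat => /or3P[].
- by case: r {IHr} => [|b c] //; rewrite inE => /eqP -> /=; rewrite inE eqxx.
- case/mapP => l' /IHl Hl ->; rewrite /= !mem_cat; apply/or3P/Or32.
  by apply/mapP; exists l.
- case/mapP => r' /IHr Hr ->; rewrite /= !mem_cat; apply/or3P/Or33.
  by apply/mapP; exists r.
Qed.

Lemma mem_left_rotations s t :
  (t \in left_rotations s) = (s \in right_rotations t).
Proof.
by apply/idP/idP; [apply: left_rotations_sub | apply: right_rotations_sub].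
Qed.

Lemma rotations_sym s t : (t \in rotations s) = (s \in rotations t).
Proof. by rewrite !mem_cat !mem_left_rotations orbC. Qed.

Lemma rotates_in_add j k s t u :
  rotates_in j s t -> rotates_in k t u -> rotates_in (j + k) s u.
Proof.
elim: j s => [|j IH] s /=; first by move/eqP ->.
case/hasP => v sv vt tu; apply/hasP; exists v => //; exact: IH vt tu.
Qed.

Lemma rotates_in_sym k s t : rotates_in k s t -> rotates_in k t s.
Proof.
elim: k s => [|k IH] s /=; first by rewrite eq_sym.
case/hasP => v sv /IH tv; rewrite -/(rotates_in k.+1 t s) -addn1.
apply: rotates_in_add tv _; apply/hasP; exists s; last exact: eqxx.
by rewrite -rotations_sym.
Qed.

Lemma rotates_in_left k l l' r :
  rotates_in k l l' -> rotates_in k (Node l r) (Node l' r).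
Proof.
elim: k l => [|k IH] l; first by move/eqP ->; apply: eqxx.
case/hasP => v; rewrite mem_cat => lv /IH vl'; apply/hasP.
exists (Node v r) => //; rewrite mem_cat /= !mem_cat.
by case/orP: lv => lv; rewrite (map_f (fun x => Node x r) lv) !orbT.
Qed.

Lemma rotates_in_right k l r r' :
  rotates_in k r r' -> rotates_in k (Node l r) (Node l r').
Proof.
elim: k r => [|k IH] r; first by move/eqP ->; apply: eqxx.
case/hasP => v; rewrite mem_cat => rv /IH vr'; apply/hasP.
exists (Node l v) => //; rewrite mem_cat /= !mem_cat.
by case/orP: rv => rv; rewrite (map_f (Node l) rv) !orbT.
Qed.

Fixpoint right_comb (n : nat) : tree :=
  if n is m.+1 then Node Leaf (right_comb m) else Leaf.

Lemma rotates_comb_Node m k :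
  rotates_in m (Node (right_comb m) (right_comb k)) (right_comb (m + k).+1).
Proof.
elim: m => [|m IH]; first exact: eqxx.
apply/hasP; exists (Node Leaf (Node (right_comb m) (right_comb k))).
  by rewrite mem_cat /= inE eqxx.
exact: rotates_in_right IH.
Qed.

Lemma nb_interior_Node l r :
  nb_interior (Node l r) = (nb_interior l + nb_interior r).+1.
Proof. by rewrite /nb_interior /= size_cat !size_map. Qed.

Lemma rotates_comb t : exists k, rotates_in k t (right_comb (nb_interior t)).
Proof.
elim: t => [|l [j Hj] r [k Hk]]; first by exists 0.
rewrite nb_interior_Node; eexists.
apply: rotates_in_add (rotates_in_left r Hj) _.
apply: rotates_in_add (rotates_in_right _ Hk) _.
exact: rotates_comb_Node.
Qed.

Lemma nb_leavesE t : nb_leaves t = (nb_interior t).+1.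
Proof.
elim: t => [|l IHl r IHr] //; rewrite nb_interior_Node.
rewrite /nb_leaves /= size_cat !size_map -/(nb_leaves l) -/(nb_leaves r).
by rewrite IHl IHr addSn addnS.
Qed.

Lemma rotations_connect (s t : tree) :
  nb_leaves s = nb_leaves t -> exists k, rotates_in k s t.
Proof.
rewrite !nb_leavesE => -[st].
have [j Hj] := rotates_comb s; have [k Hk] := rotates_comb t.
exists (j + k); apply: rotates_in_add Hj _; rewrite st.
exact: rotates_in_sym.
Qed.

Definition rotation_distance (s t : tree) (eq_st : nb_leaves s = nb_leaves t)
    : nat :=
  ex_minn (rotations_connect eq_st).

Arguments rotation_distance : clear implicits.

(* Main.v *)
(** Encode an interior node by the interval of leaf numbers below it, as a pair
    (first leaf, number of leaves).

    Lower bound: a rotation replaces a single interval, so it increases the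
    number of intervals shared with [T] by at most one.

    Upper bound: let [C] be the set of common intervals. Rotating at every node
    whose left child is interior and outside [C] turns [S], with at most one
    rotation for each interval of [S] outside [C], into a tree that still has
    all the intervals of [C] and whose interior left children are all in [C].
    There is only one such tree, so [S] and [T] both reach it, each in at most
    [n - (e + 1)] rotations, the root being the extra common interval. *)
Require Import Defs.
From mathcomp Require Import all_boot all_order all_algebra.
From mathcomp Require Import zify.
Import GRing.Theory Num.Theory.

Set Implicit Arguments.
Unset Strict Implicit.
Unset Printing Implicit Defensive.

(** * Intervals of interior nodes *)

(** [a] is the number of the leftmost leaf. The order is preorder, as in [interior_nodes], so the
    root interval is the head of the list. *)
Fixpoint intervals (a : nat) (t : tree) : seq (nat * nat) :=
  if t is Node l r
  then (a, nb_leaves t) :: intervals a l ++ intervals (a + nb_leaves l) r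
  else [::].

Lemma nb_leaves_Node l r : nb_leaves (Node l r) = nb_leaves l + nb_leaves r.
Proof. by rewrite !nb_leavesE nb_interior_Node addSn addnS. Qed.

Lemma nb_leaves_gt0 t : 0 < nb_leaves t.
Proof. by rewrite nb_leavesE. Qed.

Lemma nb_leaves_eq1 t : (nb_leaves t == 1) = (t == Leaf).
Proof. by case: t => [|l r] //; rewrite nb_leavesE nb_interior_Node. Qed.

Lemma size_intervals a t : size (intervals a t) = nb_interior t.
Proof.
elim: t a => [|l IHl r IHr] a //.
by rewrite nb_interior_Node /= size_cat IHl IHr.
Qed.

Lemma mem_intervals_Node a l r x :
  (x \in intervals a (Node l r))
  = [|| x == (a, nb_leaves l + nb_leaves r), x \in intervals a l
      | x \in intervals (a + nb_leaves l) r].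
Proof. by rewrite /= inE mem_cat nb_leaves_Node. Qed.

Definition inside (a : nat) (t : tree) (x : nat * nat) : bool :=
  [&& a <= x.1, x.1 + x.2 <= a + nb_leaves t & 1 < x.2].

Lemma intervals_inside a t x : x \in intervals a t -> inside a t x.
Proof.
elim: t a => [|l IHl r IHr] a //=; rewrite /inside nb_leaves_Node.
have := (nb_leaves_gt0 l, nb_leaves_gt0 r) => -[l0 r0].
rewrite inE mem_cat => /or3P[/eqP -> /=|/IHl/and3P[]|/IHr/and3P[]]; lia.
Qed.

(** The root interval is longer than all others, and the two children occupy disjoint leaf
    ranges. *)
Lemma intervals_uniq a t : uniq (intervals a t).
Proof.
elim: t a => [|l IHl r IHr] a //=.
have := (nb_leaves_gt0 l, nb_leaves_gt0 r) => -[l0 r0].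
rewrite cat_uniq IHl IHr andbT mem_cat nb_leaves_Node; apply/andP; split.
  by apply/negP => /orP[] /intervals_inside/and3P[/=]; lia.
apply/hasPn => x /intervals_inside/and3P[? ? ?]; apply/negP.
by move/intervals_inside/and3P => []; lia.
Qed.

(** * Leaf sets as intervals, and the count of common edges *)

Lemma leaves_below_mask t p :
  leaves_below t p = mask (map (prefix p) (leaves t)) (iota 1 (nb_leaves t)).
Proof.
rewrite /leaves_below filter_mask; congr (mask _ _).
apply: (@eq_from_nth _ false); rewrite !size_map size_iota // => i lt_i.
by rewrite (nth_map 0) ?size_iota // nth_iota // add1n /= (nth_map [::]).
Qed.

(** Induction with a free offset: the root's mask is all true, and the mask of a node in one child
    is false on the leaves of the other child. *)
Lemma leaf_masks_intervals a t :
  [seq mask (map (prefix p) (leaves t)) (iota a (nb_leaves t))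
     | p <- interior_nodes t] = [seq iota x.1 x.2 | x <- intervals a t].
Proof.
elim: t a => [|l IHl r IHr] a //=; congr cons.
  have -> : map (prefix [::]) (leaves (Node l r))
            = nseq (nb_leaves (Node l r)) true.
    by rewrite /nb_leaves; elim: (leaves _) => [|[|b x] L /= ->].
  by rewrite mask_true // size_iota.
have prefix_cons_map (b c : bool) p (L : seq address) :
    map (prefix (b :: p)) (map (cons c) L)
    = if b == c then map (prefix p) L else nseq (size L) false.
  by case: b c => [] []; elim: L => //= x L ->.
rewrite !map_cat -IHl -IHr -!map_comp nb_leaves_Node.
congr (_ ++ _); apply: eq_map => p /=;
  rewrite map_cat !prefix_cons_map iotaD mask_cat
    ?size_map ?size_nseq ?size_iota //=.
  by rewrite mask_false cats0.
by rewrite mask_false.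
Qed.

Lemma internal_edges_behead t : internal_edges t = behead (interior_nodes t).
Proof.
case: t => [|l r] //; rewrite /internal_edges /= filter_cat.
by congr (_ ++ _); rewrite filter_map; congr map; apply/all_filterP/allP.
Qed.

Lemma leaves_below_internal_edges t :
  map (leaves_below t) (internal_edges t)
  = [seq iota x.1 x.2 | x <- behead (intervals 1 t)].
Proof.
rewrite internal_edges_behead -!behead_map; congr behead.
by rewrite (eq_map (@leaves_below_mask t)) leaf_masks_intervals.
Qed.

(** Positive lengths are required because all empty ranges coincide, whatever their start. *)
Lemma iota_inj_in (s : seq (nat * nat)) :
  {in s, forall x, 0 < x.2} ->
  {in s &, injective (fun x => iota x.1 x.2)}.
Proof.
move=> s_gt0 [a k] [b j] /s_gt0 /= k0 /s_gt0 /= j0 eq_kj.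
have := congr1 size eq_kj; rewrite !size_iota => eqk.
rewrite -eqk in eq_kj j0 *.
by case: k k0 eq_kj {eqk j0} => [|k] //= _ [->].
Qed.

(** Distinct values of [g] give each [p] at most one partner, so counting pairs amounts to counting
    first components. *)
Lemma count_allpairs_eq (A B : Type) (C : eqType) (f : A -> C) (g : B -> C)
    (s : seq A) (t : seq B) :
  uniq (map g t) ->
  count (fun pq => f pq.1 == g pq.2) [seq (p, q) | p <- s, q <- t]
  = count (mem (map g t)) (map f s).
Proof.
move=> uniq_t; elim: s => [|p s IHs] //=.
rewrite count_cat IHs; congr addn.
rewrite -(count_uniq_mem (f p) uniq_t) !count_map.
by apply: eq_count => q /=; rewrite eq_sym.
Qed.

(** The successor accounts for the root interval, which is common but belongs to no edge. *)
Lemma nb_common_edgesE s t : s <> Leaf -> nb_leaves s = nb_leaves t ->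
  (nb_common_edges s t).+1 = count (mem (intervals 1 t)) (intervals 1 s).
Proof.
move=> s_node eq_st; pose iota2 (x : nat * nat) := iota x.1 x.2.
have gt1 u : {in intervals 1 u, forall x, 0 < x.2}.
  by move=> x /intervals_inside/and3P[_ _ /ltnW].
have inj_st : {in intervals 1 s ++ intervals 1 t &, injective iota2}.
  by apply: iota_inj_in => x; rewrite mem_cat => /orP[/gt1|/gt1].
have inj_t : {in behead (intervals 1 t) &, injective iota2}.
  by move=> x y /mem_behead xt /mem_behead yt;
    apply: inj_st; rewrite mem_cat ?xt ?yt orbT.
rewrite /nb_common_edges size_filter count_allpairs_eq; last first.
  rewrite leaves_below_internal_edges map_inj_in_uniq //.
  by have := intervals_uniq 1 t; case: (intervals 1 t) => [|x I] //= /andP[].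
rewrite !leaves_below_internal_edges count_map.
case: s s_node eq_st gt1 inj_st => // l r _ eq_st _ inj_st.
case: t eq_st inj_st inj_t => [|l' r'] eq_st inj_st inj_t.
  by move/eqP: eq_st; rewrite nb_leaves_eq1.
rewrite [in RHS]/= eq_st inE eqxx add1n; congr S.
apply: eq_in_count => x xs /=.
(* Both trees have the same root interval, so a non-root [x] can only match in the tail of the other
   list. *)
have x_root : x <> (1, nb_leaves (Node l r)).
  by move=> x_root; have /andP[] := intervals_uniq 1 (Node l r);
    rewrite -x_root; move/negP => [].
rewrite [in RHS]inE -eq_st (introF eqP x_root) /=.
apply/mapP/idP => [[y yt eq_xy]|xt]; last by exists x.
rewrite (inj_st x y _ _ eq_xy) // mem_cat inE; first by rewrite xs orbT.
by rewrite [X in _ || X]inE yt !orbT.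
Qed.

(** * Effect of rotations on intervals *)

Lemma rotations_nb_interior u s :
  u \in rotations s -> nb_interior u = nb_interior s.
Proof.
have right_rot s' u' :
    u' \in right_rotations s' -> nb_interior u' = nb_interior s'.
  elim: s' u' => [|l IHl r IHr] u' //=; rewrite !mem_cat => /or3P[].
  - case: l {IHl} => [|b c] //; rewrite inE => /eqP ->.
    by rewrite !nb_interior_Node; lia.
  - by case/mapP => l' /IHl eq_l ->; rewrite !nb_interior_Node eq_l.
  - by case/mapP => r' /IHr eq_r ->; rewrite !nb_interior_Node eq_r.
rewrite mem_cat mem_left_rotations => /orP[/right_rot //|/right_rot] //.
Qed.

Lemma rotates_in_nb_leaves k s t :
  rotates_in k s t -> nb_leaves s = nb_leaves t.
Proof.
rewrite !nb_leavesE; elim: k s => [|k IHk] s /=; first by move/eqP ->.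
by case/hasP => u /rotations_nb_interior <- /IHk.
Qed.

(** Rotating [((b, c), r)] only exchanges the interval of [(b, c)] for that of [(c, r)]. The two
    inequalities together also serve left rotations, the inverses. *)
Lemma right_rotations_count (P : pred (nat * nat)) a s u :
  u \in right_rotations s ->
  count P (intervals a u) <= (count P (intervals a s)).+1 /\
  count P (intervals a s) <= (count P (intervals a u)).+1.
Proof.
elim: s a u => [|l IHl r IHr] a u //= us.
have eq_ur : nb_interior u = nb_interior (Node l r).
  by apply: rotations_nb_interior; rewrite mem_cat us.
move: us eq_ur; rewrite !mem_cat => /or3P[].
- case: l {IHl} => [|b c] //; rewrite inE => /eqP -> _ /=.
  rewrite !count_cat /= !count_cat !nb_leaves_Node !addnA.
  by case: (P _); case: (P _); case: (P _); lia.
- case/mapP => l' ll -> /eqP; rewrite !nb_interior_Node eqSS eqn_add2r => eq_l.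
  have [] := IHl a _ ll; rewrite /= !count_cat !nb_leaves_Node !nb_leavesE.
  by rewrite (eqP eq_l); lia.
- case/mapP => r' rr -> /eqP; rewrite !nb_interior_Node eqSS eqn_add2l => eq_r.
  have [] := IHr (a + nb_leaves l) _ rr.
  rewrite /= !count_cat !nb_leaves_Node !nb_leavesE.
  by rewrite (eqP eq_r); lia.
Qed.

Lemma rotates_in_count (P : pred (nat * nat)) a k s t :
  rotates_in k s t -> count P (intervals a t) <= count P (intervals a s) + k.
Proof.
elim: k s => [|k IHk] s /=; first by move/eqP ->; rewrite addn0.
case/hasP => u; rewrite mem_cat mem_left_rotations => us /IHk.
case/orP: us => /(right_rotations_count P a) []; lia.
Qed.

(** * Normalization relative to a set [C] of intervals *)

Section Normalization.

Variable C : pred (nat * nat).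

Fixpoint normal (a : nat) (t : tree) : bool :=
  if t is Node l r
  then [&& (l == Leaf) || C (a, nb_leaves l),
           normal a l & normal (a + nb_leaves l) r]
  else true.

Definition keeps (a : nat) (t t' : tree) : Prop :=
  forall x, C x -> x \in intervals a t -> x \in intervals a t'.

Definition normalizes (a k : nat) (t t' : tree) : Prop :=
  [/\ rotates_in k t t', normal a t' & keeps a t t'].

(* The second half is the induction invariant: when [t] is outside [C], one
   rotation of [Node (Node l r) u] yields [Node l (Node r u)], and it remains to
   insert [r], then [l], to the left of an already normal tree. *)
Lemma normalize a t :
  (exists k t', normalizes a k t t' /\
     k <= count (predC C) (intervals a t)) /\
  (forall u, normal (a + nb_leaves t) u ->
   exists k t', normalizes a k (Node t u) t' /\
     k <= count (predC C) (intervals a t)).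
Proof.
elim: t a => [|l IHl r IHr] a.
  split; first by exists 0, Leaf; split=> //; split=> //=.
  by move=> u nu; exists 0, (Node Leaf u); split=> //; split=> //=.
have [_ insert_l] := IHl a.
have [[j [r' [[rr nr' kr] le_j]]] insert_r] := IHr (a + nb_leaves l).
have eq_r := rotates_in_nb_leaves rr.
have normalize_lr : exists k t', normalizes a k (Node l r) t' /\
    k <= count (predC C) (intervals a l)
         + count (predC C) (intervals (a + nb_leaves l) r).
  (* First [r] is normalized, in [j] rotations, then [l] is inserted to the left of the result. *)
  have [k [t' [[rt nt kt] le_k]]] := insert_l r' nr'.
  exists (j + k), t'; split; last by rewrite addnC leq_add.
  split=> //; first exact: rotates_in_add (rotates_in_right _ rr) rt.
  move=> x Cx xt; apply: (kt x Cx); move: xt; rewrite !mem_intervals_Node -eq_r.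
  by case/or3P => [->|->|/(kr x Cx) ->]; rewrite ?orbT.
have [k [t' [nt le_k]]] := normalize_lr.
split.
  exists k, t'; split=> //; rewrite /= count_cat.
  exact: leq_trans le_k (leq_addl _ _).
(* If its interval is in [C], [Node l r] may stay a left child and is normalized in place. *)
move=> u nu; case CN: (C (a, nb_leaves (Node l r))).
  have [rt nt' kt] := nt; have eq_t := rotates_in_nb_leaves rt.
  exists k, (Node t' u); split; last first.
    by rewrite /= count_cat (leq_trans le_k) ?leq_addl.
  split; first exact: rotates_in_left.
    by rewrite /= -eq_t CN orbT nt' nu.
  move=> x Cx; rewrite !(mem_intervals_Node _ _ u) -eq_t.
  by case/or3P => [->|/(kt x Cx) ->|->]; rewrite ?orbT.
rewrite nb_leaves_Node addnA in nu.
have [i [v [[rv nv kv] le_i]]] := insert_r u nu.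
have eq_v := rotates_in_nb_leaves rv.
have [h [w [[rw nw kw] le_h]]] := insert_l v nv.
(* The extra rotation is charged to the interval of [Node l r], which is outside [C]. *)
exists (1 + (i + h)), w; split; last first.
  by rewrite /= count_cat /= CN /= add1n ltnS addnC leq_add.
split=> //.
  apply: (@rotates_in_add 1 _ _ (Node l (Node r u))).
    by apply/hasP; exists (Node l (Node r u)); rewrite /= ?mem_cat /= ?inE eqxx.
  exact: rotates_in_add (rotates_in_right _ rv) rw.
move=> x Cx xt; apply: (kw x Cx); move: xt.
(* This is the only interval that the rotation destroys. *)
have xN : (x == (a, nb_leaves l + nb_leaves r)) = false.
  by rewrite -nb_leaves_Node; apply/eqP => x_eq; rewrite x_eq CN in Cx.
rewrite !mem_intervals_Node -eq_v xN !nb_leaves_Node !addnA /=.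
case/or3P => [->//|/orP[->|xr]|xu]; first by rewrite orbT.
  by rewrite (kv x Cx) ?orbT // mem_intervals_Node xr orbT.
by rewrite (kv x Cx) ?orbT // mem_intervals_Node xu !orbT.
Qed.

(** * Uniqueness of the normal tree *)

Definition covers (a : nat) (t : tree) : Prop :=
  forall x, C x -> inside a t x -> x \in intervals a t.

(** An interval within the range of one child is neither the root's, which is longer, nor one from
    the other child's disjoint range. *)
Lemma covers_Node a l r :
  covers a (Node l r) -> covers a l /\ covers (a + nb_leaves l) r.
Proof.
have := (nb_leaves_gt0 l, nb_leaves_gt0 r) => -[l0 r0] cov.
split=> x Cx x_in; have {cov} := cov x Cx; move: x_in;
  rewrite /inside nb_leaves_Node /= => /and3P[x1 x2 x3].
all: have -> : [&& a <= x.1, x.1 + x.2 <= a + (nb_leaves l + nb_leaves r)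
        & 1 < x.2] by lia.
all: move/(_ isT); rewrite inE mem_cat => /or3P[/eqP x_eq|xl|xr] //.
all: try by move: x1 x2; rewrite x_eq nb_leaves_Node /=; lia.
  by case/intervals_inside/and3P: xr; lia.
by case/intervals_inside/and3P: xl; lia.
Qed.

(** A longer [l'] would be interior, with its interval in [C] and hence in [Node l r]; but no
    interval starting at [a] there has a length strictly between those of [l] and of the root. *)
Lemma normal_left_le a l r l' r' :
  nb_leaves (Node l r) = nb_leaves (Node l' r') ->
  covers a (Node l r) -> normal a (Node l' r') ->
  nb_leaves l' <= nb_leaves l.
Proof.
have := (nb_leaves_gt0 l, nb_leaves_gt0 r') => -[l0 r0].
move=> eq_lr cov /= /and3P[/orP[/eqP -> //|Cl'] _ _].
rewrite leqNgt; apply/negP => lt_l.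
have /(cov _ Cl') : inside a (Node l r) (a, nb_leaves l').
  by rewrite /inside eq_lr nb_leaves_Node /=; lia.
rewrite /= inE mem_cat eq_lr nb_leaves_Node => /or3P[/eqP[]||]; first lia.
  by move/intervals_inside/and3P => [/=]; lia.
by move/intervals_inside/and3P => [/=]; lia.
Qed.

(** [normal_left_le] in both directions forces the same split of the leaves at the root; induction
    does the rest. *)
Lemma normal_inj a s t : nb_leaves s = nb_leaves t ->
  normal a s -> normal a t -> covers a s -> covers a t -> s = t.
Proof.
elim: s a t => [|l IHl r IHr] a [|l' r'] // eq_st.
- by move/esym/eqP: eq_st; rewrite nb_leaves_eq1.
- by move/eqP: eq_st; rewrite nb_leaves_eq1.
move=> ns nt cs ct.
have eq_l : nb_leaves l = nb_leaves l'.
  by apply/eqP; rewrite eqn_leq (normal_left_le (esym eq_st) ct ns)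
    (normal_left_le eq_st cs nt).
have eq_r : nb_leaves r = nb_leaves r'.
  by move: eq_st; rewrite !nb_leaves_Node eq_l => /addnI.
case/and3P: ns => _ nl nr; case/and3P: nt => _ nl' nr'.
have [cl cr] := covers_Node cs; have [cl' cr'] := covers_Node ct.
rewrite (IHl a l') //; rewrite eq_l in nr cr.
by rewrite (IHr (a + nb_leaves l') r').
Qed.

End Normalization.

(** * The two bounds *)

Lemma rotates_in_common s t : nb_leaves s = nb_leaves t ->
  exists2 k, rotates_in k s t
    & k <= count (predC (mem (intervals 1 t))) (intervals 1 s)
           + count (predC (mem (intervals 1 s))) (intervals 1 t).
Proof.
move=> eq_st.
pose C x := (x \in intervals 1 s) && (x \in intervals 1 t).
have [[j [s' [[rs ns ks] le_j]]] _] := normalize C 1 s.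
have [[k [t' [[rt nt kt] le_k]]] _] := normalize C 1 t.
have eq_st' : s' = t'.
  apply: (normal_inj (C := C) (a := 1)) => //.
  - by rewrite -(rotates_in_nb_leaves rs) eq_st (rotates_in_nb_leaves rt).
  - by move=> x Cx _; apply: ks => //; case/andP: Cx.
  - by move=> x Cx _; apply: kt => //; case/andP: Cx.
exists (j + k).
  by apply: rotates_in_add rs _; rewrite eq_st'; apply: rotates_in_sym.
(* For an interval of one tree, being outside [C] means not being an interval of the other. *)
apply: leq_add; [apply: leq_trans le_j _|apply: leq_trans le_k _];
  rewrite leq_eqVlt; apply/orP; left; apply/eqP; apply: eq_in_count => x xs;
  by rewrite /= /C xs ?andbT.
Qed.

Theorem theorem1 (S T : tree) (n e : nat)
    (distinct_ST : S <> T)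
    (same_leaves : nb_leaves S = nb_leaves T)
    (nS : nb_interior S = n) (nT : nb_interior T = n)
    (eST : nb_common_edges S T = e) :
  (n%:Z - e%:Z - 1 <= (rotation_distance S T same_leaves)%:Z
     <= 2 * (n%:Z - e%:Z - 1))%R.
Proof.
have S_node : S <> Leaf.
  move=> S_leaf; apply: distinct_ST; apply/esym/eqP.
  by rewrite S_leaf -nb_leaves_eq1 -same_leaves S_leaf.
have common := nb_common_edgesE S_node same_leaves.
have common_sym : count (mem (intervals 1 S)) (intervals 1 T)
                  = count (mem (intervals 1 T)) (intervals 1 S).
  rewrite -!size_filter; apply: perm_size; apply: uniq_perm;
    rewrite ?filter_uniq ?intervals_uniq // => x.
  by rewrite !mem_filter andbC.
(* Each tree has [n] intervals, [e + 1] of them common, which leaves [n - e - 1] to pay for on each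
   side. *)
have := count_predC (mem (intervals 1 T)) (intervals 1 S).
have := count_predC (mem (intervals 1 S)) (intervals 1 T).
rewrite common_sym -common eST !size_intervals nS nT => countT countS.
rewrite /rotation_distance; case: ex_minnP => d rot_d min_d.
have [k /min_d le_dk le_k] := rotates_in_common same_leaves.
(* [T] shares all [n] intervals with itself and [S] shares [e + 1] with it, so [n <= e + 1 + d]. *)
have := rotates_in_count (mem (intervals 1 T)) 1 rot_d.
rewrite -common eST (eq_in_count (a2 := predT)) => [|x /= ->//].
rewrite count_predT size_intervals nT => le_n.
by apply/andP; split; lia.
Qed.
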